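(* Let $(P,\le)$ be a finite connected poset and let $\pi\in\Pi_P$ be a maximal chain (path) of $P$. The minimal set of inequalities defining the cone $\mathcal{C}(\pi)$ is the set of inequalities (in the variable $\omega\in\mathbb{R}^P$) of the form: (i) $\omega(\mathbf{v})\ge 0$ for $\mathbf{v}\in P\setminus\pi$; (ii) $\omega(\mathbf{v})\ge 0$ for $\mathbf{v}\in\pi$ such that $\mathbf{v}$ is not a corner of $\pi$; (iii) $\langle\omega,\pi-\pi'\rangle\ge 0$ for paths $\pi'\in\Pi_P\setminus\{\pi\}$ whose disorder graph $\Delta(\pi,\pi')$ with $\pi$ is connected. That is, $\mathcal{C}(\pi)$ is exactly the set of $\omega\in\mathbb{R}^P$ satisfying all inequalities in (i), (ii), (iii), and removing any single one of these inequalities yields a set strictly larger than $\mathcal{C}(\pi)$.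
   Context: $P$ is connected means that its Hasse diagram is connected as a graph. $\Pi_P$ denotes the set of maximal chains of $P$, called paths. A path $\pi$ is identified with its indicator vector $\pi(\mathbf{v})=\mathbf{1}\{\mathbf{v}\in\pi\}$ in $\mathbb{R}^P$, and $\langle\cdot,\cdot\rangle$ is the standard inner product on $\mathbb{R}^P$. With $\mathbb{R}_+=[0,\infty)$, for $\pi\in\Pi_P$, $$\mathcal{C}(\pi)=\{\omega\in\mathbb{R}_+^P:\langle\omega,\pi\rangle\ge\langle\omega,\pi'\rangle\text{ for all }\pi'\in\Pi_P\}.$$ Corner: $\mathbf{v}\in P$ is a corner of $\pi\in\Pi_P$ if $\mathbf{v}\in\pi$ and there exists another path $\pi'\in\Pi_P$ with $\pi\setminus\{\mathbf{v}\}\subset\pi'$ and $\mathbf{v}\notin\pi'$. Disorder graph: for $\pi,\pi'\in\Pi_P$, $\Delta(\pi,\pi')$ is the graph whose vertex set is the symmetric difference $(\pi\setminus\pi')\cup(\pi'\setminus\pi)$, with an edge between $\mathbf{u}$ and $\mathbf{v}$ precisely when $\mathbf{u}$ and $\mathbf{v}$ are out of order, i.e. incomparable in $P$. *)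

(* Defs.v *)
From mathcomp Require Import all_boot all_order all_algebra.
From mathcomp Require Import all_classical all_reals.

Set Implicit Arguments.
Unset Strict Implicit.
Unset Printing Implicit Defensive.

Import Order.TTheory GRing.Theory Num.Theory.

Local Open Scope classical_set_scope.
Local Open Scope ring_scope.

(* The subgraph of [e] induced on [A] is connected; [e] is meant to be
   symmetric. The empty graph counts as connected. *)
Definition induced_connected (T : finType) (A : {set T}) (e : rel T) : Prop :=
  {in A &, forall u v,
     connect [rel x y | [&& x \in A, y \in A & e x y]] u v}.

Section Poset.
Variables (d : Order.disp_t) (P : finPOrderType d).
Implicit Types (u v : P) (A pi : {set P}).

Definition covered_by u v : bool :=
  (u < v)%O && [forall w : P, ~~ ((u < w)%O && (w < v)%O)].

Definition hasse : rel P := [rel u v | covered_by u v || covered_by v u].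

Definition connected_poset : Prop := induced_connected [set: P]%SET hasse.

Definition is_chain A : bool :=
  [forall u in A, forall v in A, (u >=< v)%O].

Definition is_path pi : bool := maxset is_chain pi.

Definition corner pi v : Prop :=
  v \in pi /\
  exists pi' : {set P},
    [/\ is_path pi', pi' != pi, pi :\ v \subset pi' & v \notin pi'].

Definition disorder_vertices pi pi' : {set P} :=
  (pi :\: pi') :|: (pi' :\: pi).

Definition disorder_connected pi pi' : Prop :=
  induced_connected (disorder_vertices pi pi') [rel u v | (u >< v)%O].

(* Formal inequalities. They are kept as syntax, rather than as half-spaces, so
   that each one can be removed individually from a family. *)
Inductive inequality : Type :=
  | CoordGe0 of P
  | PathGe of {set P}.

Variable R : realType.
Implicit Types (w x y : {ffun P -> R}).

Definition indicator A : {ffun P -> R} := [ffun v => (v \in A)%:R].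

Definition dot x y : R := \sum_(v : P) x v * y v.

Definition cone pi : set {ffun P -> R} :=
  [set w : {ffun P -> R} | (forall v, 0 <= w v) /\
           (forall pi', is_path pi' ->
              dot w (indicator pi) >= dot w (indicator pi'))].

Definition satisfies pi w (c : inequality) : Prop :=
  match c with
  | CoordGe0 v => 0 <= w v
  | PathGe pi' => 0 <= dot w (indicator pi - indicator pi')
  end.

Definition solutions pi (F : set inequality) : set {ffun P -> R} :=
  [set w | forall c, F c -> satisfies pi w c].

End Poset.

Arguments CoordGe0 {d P}.
Arguments PathGe {d P}.
Arguments cone {d P} R pi _.
Arguments solutions {d P} R pi F _.

Definition facet_inequalities (d : Order.disp_t) (P : finPOrderType d)
    (pi : {set P}) : set (inequality P) :=
  [set c | match c with
           | CoordGe0 v => v \notin pi \/ (v \in pi /\ ~ corner pi v)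
           | PathGe pi' =>
               [/\ is_path pi', pi' != pi & disorder_connected pi pi']
           end].

(* Main.v *)
Require Import Defs.
From mathcomp Require Import all_boot all_order all_algebra.
From mathcomp Require Import all_classical all_reals.
From mathcomp Require Import zify fintype finset.

(** Two paths [pi] and [rho] meet in a part [I] and differ in
    [X = pi :\: rho] and [Y = rho :\: pi]; since each path is a chain, the
    disorder graph is bipartite between [X] and [Y], and since each path is
    maximal, it has no isolated vertex.

    Why the listed inequalities suffice.  At a corner [v] of [pi], the path
    [rho] that witnesses the corner has as disorder graph a star centred at
    [v], so the listed inequality for [rho] bounds [w v] below by coordinates
    off [pi], which are nonnegative ([corner_star]).  Hence [w >= 0].  If the
    disorder graph of [pi] and [rho] splits into two nonempty parts [K] and
    [L] with no edge between them, then replacing in [pi] only the vertices of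
    [K], or only those of [L], by those of [rho] gives two chains whose weights
    add up to those of [pi] and [rho].  Such a chain need not be maximal, but
    as [w >= 0] a path through it is at least as heavy, and this path is closer
    to [pi] than [rho] is ([exchange_path]).  Induction on [#|pi :\: rho|] then
    bounds the weight of every path by that of [pi] ([path_sum_le]).

    Why none can be removed.  For each inequality some [w] violates it and
    satisfies the others.  For a vertex [v] off [pi], take minus the indicator
    of [v].  For a vertex [v] of [pi] that is no corner, take the indicator of
    [pi :\ v] minus that of [v]: a path avoiding [v] misses another vertex of
    [pi] as well.  For a path [rho] whose disorder graph with [pi] is connected,
    weight each vertex of the graph by twice its degree.  A path meets the graph
    in an independent set, so its weight is at most twice the number of edges,
    and by connectedness equality forces this set to be [X] or [Y]
    ([edge_cover_alternates]).  Adding 2 on [I] and then 1 on a single vertex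
    of [Y] makes [rho] the only path heavier than [pi] ([peak_weight_le]). *)

Set Implicit Arguments.
Unset Strict Implicit.
Unset Printing Implicit Defensive.

Import Order.TTheory GRing.Theory Num.Theory.

Local Open Scope ring_scope.

(** * Paths and their disorder graphs *)

Section Paths.
Variables (d : Order.disp_t) (P : finPOrderType d).
Implicit Types (u v x y z : P) (A B K pi rho : {set P}).

Lemma chain_comparable A u v :
  is_chain A -> u \in A -> v \in A -> (u >=< v)%O.
Proof. by move=> /forall_inP cA uA vA; apply: (forall_inP (cA u uA)). Qed.

Lemma chainI A : {in A &, forall u v, (u >=< v)%O} -> is_chain A.
Proof. by move=> cA; do 2![apply/forall_inP => ? ?]; apply: cA. Qed.

Lemma path_chain pi : is_path pi -> is_chain pi.
Proof. by case/maxsetP. Qed.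

Lemma path_sub_eq pi rho : is_path pi -> is_path rho -> pi \subset rho ->
  rho = pi.
Proof. by case/maxsetP => _ pimax /path_chain; apply: pimax. Qed.

Lemma chain_extends A : is_chain A -> exists2 pi, is_path pi & A \subset pi.
Proof. by case/maxset_exists => pi; exists pi. Qed.

Lemma path_incomparable pi z :
  is_path pi -> z \notin pi -> exists2 u, u \in pi & (z >< u)%O.
Proof.
move=> pi_path zpi; apply/exists_inP; rewrite -negb_forall_in.
apply: contra zpi => /forall_inP cz.
case/maxsetP: pi_path => pi_chain pimax.
suff /pimax <- : is_chain (z |: pi) by rewrite ?setU11 ?subsetUr.
apply: chainI => a b; rewrite !inE => /predU1P[->|api] /predU1P[->|bpi].
- exact: comparablexx.
- exact: cz.
- by rewrite comparable_sym; apply: cz.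
- exact: chain_comparable pi_chain _ _.
Qed.

(** By maximality [u] has a neighbour in [pi], and that neighbour cannot lie in
    the chain [rho], which contains [u]. *)
Lemma disorder_neighbor pi rho u :
  is_path pi -> is_path rho -> u \in disorder_vertices pi rho ->
  u \notin pi -> exists2 p, p \in pi :\: rho & (u >< p)%O.
Proof.
move=> pi_path rho_path; rewrite !inE => uD upi.
have [p ppi up] := path_incomparable pi_path upi.
exists p => //; rewrite inE ppi andbT.
apply: contra up => prho; apply: chain_comparable (path_chain rho_path) _ prho.
by move: uD; rewrite (negbTE upi) andbF.
Qed.

(** A union [K] of components of the disorder graph can be exchanged on its own:
    a vertex of [pi] outside [K] is comparable to [rho :&: K], either because it
    lies in [rho] too, or because no edge leaves [K].  The resulting chain may
    fail to be maximal, hence the inclusion in [sigma].  If [K] is not the whole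
    graph, the rest of the graph contains a vertex of [pi :\: rho], which
    [sigma] keeps; so the distance to [pi] strictly drops. *)
Lemma exchange_path pi rho K :
  is_path pi -> is_path rho ->
  K \subset disorder_vertices pi rho ->
  {in K & disorder_vertices pi rho :\: K, forall u v, (u >=< v)%O} ->
  disorder_vertices pi rho :\: K != set0 ->
  exists sigma : {set P}, [/\ is_path sigma,
    (pi :\: K) :|: (rho :&: K) \subset sigma
    & (#|pi :\: sigma| < #|pi :\: rho|)%N].
Proof.
move=> pi_path rho_path KD sepK /set0Pn[v vDK].
have pi_chain := path_chain pi_path; have rho_chain := path_chain rho_path.
have cross a b : a \in pi :\: K -> b \in rho :&: K -> (a >=< b)%O.
  rewrite !inE => /andP[aK api] /andP[brho bK].
  have [arho|arho] := boolP (a \in rho); first exact: chain_comparable rho_chain _ _.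
  by rewrite comparable_sym; apply: sepK; rewrite // !inE aK arho api.
have /chain_extends[sigma sigma_path subs] :
    is_chain ((pi :\: K) :|: (rho :&: K)).
  apply: chainI => a b; rewrite 2!in_setU => /orP[aA|aB] /orP[bA|bB].
  - by move: aA bA; rewrite !inE => /andP[_ +] /andP[_ +]; apply: chain_comparable.
  - exact: cross.
  - by rewrite comparable_sym; apply: cross.
  - by move: aB bB; rewrite !inE => /andP[+ _] /andP[+ _]; apply: chain_comparable.
exists sigma; split => //; apply: proper_card; apply/properP; split.
  apply/subsetP => a; rewrite !inE => /andP[asig api]; rewrite api andbT.
  have aK : a \in K.
    by apply: contraR asig => aK; apply: (subsetP subs); rewrite !inE aK api.
  by have := subsetP KD _ aK; rewrite !inE api /= andbT orbF.
(* If [v] is not itself in [pi], its neighbour in [pi :\: rho] will do, since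
   no edge leaves [K]. *)
have [p] : exists2 p, p \in pi :\: rho & p \notin K.
  have [vpi|vpi] := boolP (v \in pi).
    by exists v; move: vDK; rewrite !inE vpi /= andbT ?orbF => /andP[].
  have vD : v \in disorder_vertices pi rho by move: vDK; rewrite inE => /andP[].
  have [p pX vp] := disorder_neighbor pi_path rho_path vD vpi.
  by exists p => //; apply: contra vp => pK; rewrite comparable_sym; apply: sepK.
rewrite inE => /andP[prho ppi] pK; exists p; rewrite !inE ppi ?prho // andbT negbK.
by apply: (subsetP subs); rewrite !inE pK ppi.
Qed.

(** The graph is a star: apart from [v], its vertices lie in [rho :\: pi], and
    their neighbours in [pi :\: rho] can only be [v]. *)
Lemma corner_star pi rho v :
  is_path pi -> is_path rho -> v \in pi -> v \notin rho ->
  pi :\ v \subset rho -> disorder_connected pi rho.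
Proof.
move=> pi_path rho_path vpi vrho sub.
set D := disorder_vertices pi rho.
have vD : v \in D by rewrite !inE vpi vrho.
have adj x : x \in D -> x != v -> (x >< v)%O.
  move=> xD xv.
  have xpi : x \notin pi.
    apply/negP => xpi; have xrho : x \in rho.
      by apply: (subsetP sub); rewrite !inE xv xpi.
    by move: xD; rewrite !inE xpi xrho.
  have [p] := disorder_neighbor pi_path rho_path xD xpi.
  rewrite inE => /andP[prho ppi].
  suff /eqP-> : p == v by [].
  by apply: contraR prho => pv; apply: (subsetP sub); rewrite !inE pv ppi.
move=> a b aD bD; apply: (@connect_trans _ _ v).
  have [->|av] := eqVneq a v; first exact: connect0.
  by apply: connect1; rewrite /= aD vD adj.
have [->|bv] := eqVneq b v; first exact: connect0.
by apply: connect1; rewrite /= bD vD comparable_sym adj.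
Qed.

End Paths.

(** * Reduction to connected disorder graphs *)

Section Cone.
Variables (R : realType) (d : Order.disp_t) (P : finPOrderType d).
Implicit Types (w : {ffun P -> R}) (A B K L pi rho : {set P}).

Lemma dot_indicator w A : dot w (indicator R A) = \sum_(v in A) w v.
Proof.
rewrite /dot [RHS]big_mkcond; apply: eq_bigr => v _; rewrite ffunE.
by case: (v \in A); rewrite ?mulr1 ?mulr0.
Qed.

Lemma satisfies_PathGe pi rho w :
  satisfies pi w (PathGe rho) <-> \sum_(v in rho) w v <= \sum_(v in pi) w v.
Proof.
rewrite /= -!dot_indicator -[dot w (indicator R rho) <= _]subr_ge0.
suff -> : dot w (indicator R pi - indicator R rho) =
  dot w (indicator R pi) - dot w (indicator R rho) by [].
rewrite /dot -sumrB; apply: eq_bigr => v _.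
by rewrite !ffunE mulrBr.
Qed.

Lemma sum_subset_le w A B : (forall v, 0 <= w v) -> A \subset B ->
  \sum_(v in A) w v <= \sum_(v in B) w v.
Proof.
move=> w0 AB; rewrite (big_setID (A := B) A) /= (setIidPr AB) lerDl.
exact: sumr_ge0.
Qed.

(** Each vertex occurs in the two exchanged chains together exactly as often as
    in [pi] and [rho] together. *)
Lemma sum_exchange w pi rho K L :
  K :|: L = disorder_vertices pi rho -> [disjoint K & L] ->
  \sum_(v in (pi :\: K) :|: (rho :&: K)) w v +
    \sum_(v in (pi :\: L) :|: (rho :&: L)) w v =
  \sum_(v in pi) w v + \sum_(v in rho) w v.
Proof.
move=> KL disj.
rewrite big_mkcond [X in _ + X]big_mkcond [X in _ = X + _]big_mkcond.
rewrite [X in _ = _ + X]big_mkcond -!big_split; apply: eq_bigr => v _ /=.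
have := disjointFr disj (x := v); have /setP/(_ v) := KL.
rewrite !inE.
by case: (v \in pi); case: (v \in rho); case: (v \in K); case: (v \in L) => //=
  h1 h2; rewrite ?addr0 ?add0r //; have := h2 isT.
Qed.

(** If the disorder graph of [rho] is disconnected, split it into a component
    and the rest; the two paths obtained by exchanging one part each are closer
    to [pi], and the sum of their weights is at least that of [pi] and [rho]. *)
Lemma path_sum_le pi w :
  is_path pi -> (forall v, 0 <= w v) ->
  (forall rho, is_path rho -> rho != pi -> disorder_connected pi rho ->
     \sum_(v in rho) w v <= \sum_(v in pi) w v) ->
  forall rho, is_path rho -> \sum_(v in rho) w v <= \sum_(v in pi) w v.
Proof.
move=> pi_path w0 wpi rho.
have [n] := ubnP #|pi :\: rho|; elim: n rho => // n IHn rho ltn rho_path.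
have [->//|neq] := eqVneq rho pi.
set D := disorder_vertices pi rho.
set e := [rel x y | [&& x \in D, y \in D & (x >< y)%O]].
have [/forall_inP conn|] := boolP [forall u in D, forall v in D, connect e u v].
  by apply: wpi => // u v uD vD; apply: (forall_inP (conn u uD)).
rewrite negb_forall_in => /exists_inP[u uD].
rewrite negb_forall_in => /exists_inP[v vD nuv].
pose K := [set x in D | connect e u x]%SET.
have KD : K \subset D by apply/subsetP => x; rewrite inE => /andP[].
have sepK : {in K & D :\: K, forall x y, (x >=< y)%O}.
  move=> x y; rewrite [x \in K]inE => /andP[xD ux] /setDP[yD yK].
  apply: contraR yK => xy; rewrite inE yD.
  by apply: connect_trans ux (connect1 _); rewrite /= xD yD xy.
have DDK : D :\: (D :\: K) = K by rewrite setDDr setDv set0U; apply/setIidPr.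
have [|s1 [s1_path sub1 lt1]] := exchange_path pi_path rho_path KD sepK.
  by apply/set0Pn; exists v; rewrite inE vD andbT inE (negbTE nuv) andbF.
have [|||s2 [s2_path sub2 lt2]] :=
    @exchange_path _ _ pi rho (D :\: K) pi_path rho_path.
- exact: subsetDl.
- by rewrite DDK => x y xK yK; rewrite comparable_sym; apply: sepK.
- by rewrite DDK; apply/set0Pn; exists u; rewrite inE uD connect0.
have IH1 := IHn _ (leq_trans lt1 ltn) s1_path.
have IH2 := IHn _ (leq_trans lt2 ltn) s2_path.
have sumE : \sum_(v in (pi :\: K) :|: (rho :&: K)) w v +
      \sum_(v in (pi :\: (D :\: K)) :|: (rho :&: (D :\: K))) w v =
    \sum_(v in pi) w v + \sum_(v in rho) w v.
  apply: sum_exchange; first by rewrite -{1}(setIidPr KD) setID.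
  by rewrite disjoint_sym disjoints_subset setDE subsetIr.
have le1 := le_trans (sum_subset_le w0 sub1) IH1.
have le2 := le_trans (sum_subset_le w0 sub2) IH2.
by have := lerD le1 le2; rewrite sumE lerD2l.
Qed.

End Cone.

(** * A weight for which a single path beats pi *)

Section Separation.
Variables (d : Order.disp_t) (P : finPOrderType d).
Implicit Types (v x y : P) (A pi rho sigma : {set P}).

Lemma sum_delta (S : pzSemiRingType) A v :
  \sum_(x in A) (x == v)%:R = (v \in A)%:R :> S.
Proof.
have [vA|vA] := boolP (v \in A); last first.
  by rewrite big1 // => x xA; case: eqP => // xv; rewrite -xv xA in vA.
by rewrite (bigD1 v) //= eqxx big1 ?addr0 // => x /andP[_ /negbTE->].
Qed.

Definition cross_edges pi rho : {set P * P} :=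
  [set e | [&& e.1 \in pi :\: rho, e.2 \in rho :\: pi & (e.1 >< e.2)%O]]%SET.

(** The inner sum is the degree of [v] in the disorder graph; the factors 2
    leave room for the extra unit at [y] to be smaller than any other change. *)
Definition peak_weight pi rho y v : nat :=
  (2 * (\sum_(e in cross_edges pi rho) ((v == e.1) + (v == e.2))) +
   2 * (v \in pi :&: rho) + (v == y))%N.

Lemma sum_peak_weight pi rho y A :
  (\sum_(v in A) peak_weight pi rho y v =
   2 * (\sum_(e in cross_edges pi rho) ((e.1 \in A) + (e.2 \in A))) +
   2 * #|A :&: (pi :&: rho)| + (y \in A))%N.
Proof.
have sum_eq x : (\sum_(v in A) (v == x) = (x \in A))%N.
  by have := sum_delta nat A x; rewrite natn => <-;
    apply: eq_bigr => i _; rewrite natn.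
under eq_bigr do rewrite /peak_weight.
rewrite [LHS]big_split /= sum_eq; congr (_ + _)%N.
rewrite [LHS]big_split /= -!big_distrr /=; congr (2 * _ + 2 * _)%N.
  rewrite exchange_big; apply: eq_bigr => e _.
  by rewrite big_split /= !sum_eq.
rewrite -sum1_card [RHS]big_mkcond [LHS]big_mkcond; apply: eq_bigr => v _.
by rewrite [v \in A :&: _]inE; do 2!case: (_ \in _).
Qed.

(** A chain [sigma] has at most one end of each edge.  If it has exactly one end
    of each, then membership in [sigma] and membership in [pi] both flip along
    every edge, so by connectedness they agree on all vertices of the graph or
    on none. *)
Lemma edge_cover_alternates pi rho sigma :
  is_path pi -> is_path rho -> is_chain sigma -> disorder_connected pi rho ->
  {in cross_edges pi rho, forall e, (e.1 \in sigma) || (e.2 \in sigma)} ->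
  rho :\: pi \subset sigma \/ [disjoint rho :\: pi & sigma].
Proof.
move=> /path_chain pi_chain /path_chain rho_chain sigma_chain conn cover.
have [/existsP[y /andP[yY ys]]|] :=
  boolP [exists y, (y \in rho :\: pi) && (y \in sigma)];
  last first.
  rewrite negb_exists => /forallP dis; right.
  rewrite disjoints_subset; apply/subsetP => y yY; rewrite inE.
  by have := dis y; rewrite yY.
left; apply/subsetP => z zY.
have not_both A u v : is_chain A -> (u >< v)%O -> ~~ ((u \in A) && (v \in A)).
  by move=> A_chain; apply: contra => /andP[]; apply: chain_comparable.
(* Constant along edges, hence on the whole graph. *)
set a := [pred v | (v \in sigma) == (v \in pi)].
have YD u : u \in rho :\: pi -> u \in disorder_vertices pi rho.
  by move=> uY; rewrite inE uY orbT.
have cl : closed [rel x y | [&& x \in disorder_vertices pi rho,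
    y \in disorder_vertices pi rho & (x >< y)%O]] a.
  move=> u v /= /and3P[uD vD uv]; rewrite /a !unfold_in.
  move: (not_both _ _ _ pi_chain uv) (not_both _ _ _ rho_chain uv)
    (not_both _ _ _ sigma_chain uv) (introT implyP (cover (u, v)))
    (introT implyP (cover (v, u))) uD vD.
  rewrite !inE /= uv comparable_sym uv.
  by case: (u \in pi); case: (v \in pi); case: (u \in rho); case: (v \in rho);
    case: (u \in sigma); case: (v \in sigma).
have := closed_connect cl (conn y z (YD _ yY) (YD _ zY)).
rewrite ![in X in X -> _]inE ys; move: yY zY.
rewrite !inE => /andP[/negbTE-> _] /andP[/negbTE-> _].
by case: (z \in sigma).
Qed.

Lemma peak_weight_lt pi rho y :
  y \in rho :\: pi ->
  (\sum_(v in pi) peak_weight pi rho y v <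
   \sum_(v in rho) peak_weight pi rho y v)%N.
Proof.
rewrite inE => /andP[ypi yrho]; rewrite !sum_peak_weight (negbTE ypi) yrho.
rewrite addn0 addn1 ltnS; apply: leq_add.
  rewrite leq_mul2l /=; apply: leq_sum => e.
  by rewrite !inE => /and3P[/andP[/negbTE-> ->] /andP[/negbTE-> ->] _].
by rewrite setIA setIid setIA [rho :&: pi]setIC -setIA setIid.
Qed.

(** For [sigma] to be heavier than [pi] it must contain [y], meet every edge and
    contain [pi :&: rho]; then it contains [rho :\: pi], hence all of [rho]. *)
Lemma peak_weight_le pi rho sigma y :
  is_path pi -> is_path rho -> is_path sigma -> disorder_connected pi rho ->
  y \in rho :\: pi -> sigma != rho ->
  (\sum_(v in sigma) peak_weight pi rho y v <=
   \sum_(v in pi) peak_weight pi rho y v)%N.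
Proof.
move=> pi_path rho_path sigma_path conn yY neq.
have sigma_chain := path_chain sigma_path.
have ypi : (y \in pi) = false by move: yY; rewrite inE => /andP[/negbTE].
rewrite !sum_peak_weight ypi addn0.
have -> : pi :&: (pi :&: rho) = pi :&: rho by rewrite setIA setIid.
set E := cross_edges pi rho; set I := pi :&: rho.
have edge_pi e : e \in E -> ((e.1 \in pi) + (e.2 \in pi) = 1)%N.
  by rewrite !inE => /and3P[/andP[_ ->] /andP[/negbTE-> _] _].
have edge_sigma e : e \in E -> ((e.1 \in sigma) + (e.2 \in sigma) <= 1)%N.
  rewrite inE => /and3P[_ _]; apply: contraR; rewrite -ltnNge => both.
  apply: (chain_comparable sigma_chain); move: both.
    by case: (e.1 \in sigma) => //; case: (_ \in _).
  by case: (e.2 \in sigma) => //; case: (_ \in _).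
have -> : (\sum_(e in E) ((e.1 \in pi) + (e.2 \in pi)) = \sum_(e in E) 1)%N.
  exact: eq_bigr.
have leE : (\sum_(e in E) ((e.1 \in sigma) + (e.2 \in sigma)) <= \sum_(e in E) 1)%N.
  exact: leq_sum.
have leI : (#|sigma :&: I| <= #|I|)%N by rewrite subset_leq_card // subsetIr.
have [ys|ys] := boolP (y \in sigma); last by lia.
have [ltE|geE] := ltnP (\sum_(e in E) ((e.1 \in sigma) + (e.2 \in sigma)))
  (\sum_(e in E) 1)%N; first by lia.
suff : (#|sigma :&: I| < #|I|)%N by lia.
have cover : {in E, forall e, (e.1 \in sigma) || (e.2 \in sigma)}.
  move=> e eE; apply: contraLR geE; rewrite negb_or => /andP[/negbTE s1 /negbTE s2].
  rewrite -ltnNge (bigD1 e) //= [ltnRHS](bigD1 e) //= s1 s2 add0n ltnS.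
  by apply: leq_sum => f /andP[fE _]; apply: edge_sigma.
have [Ys|] := edge_cover_alternates pi_path rho_path sigma_chain conn cover; last first.
  by move=> /disjointFr/(_ yY); rewrite ys.
apply: proper_card; rewrite properE subsetIr /=.
apply: contra neq; rewrite subsetI => /andP[Is _].
apply/eqP; apply: path_sub_eq => //; apply/subsetP => x xrho.
have [xpi|xpi] := boolP (x \in pi).
  by apply: (subsetP Is); rewrite !inE xpi.
by apply: (subsetP Ys); rewrite !inE xpi.
Qed.

End Separation.

(** * The facets of the cone of a path *)

Local Open Scope classical_set_scope.

Theorem theorem1p1 (R : realType) (d : Order.disp_t) (P : finPOrderType d)
    (Pconn : connected_poset P) (pi : {set P}) (pi_path : is_path pi) :
  cone R pi = solutions R pi (facet_inequalities pi) /\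
  (forall c : inequality P, facet_inequalities pi c ->
     cone R pi `<` solutions R pi (facet_inequalities pi `\ c)).
Proof.
have coneE : cone R pi = solutions R pi (facet_inequalities pi).
  apply/seteqP; split => w /=.
    move=> [w0 wpi] [v|rho]; first by move=> _; apply: w0.
    case=> rho_path _ _; apply/satisfies_PathGe.
    by rewrite -!dot_indicator; apply: wpi.
  move=> sol.
  have wpath rho : is_path rho -> rho != pi -> disorder_connected pi rho ->
      \sum_(v in rho) w v <= \sum_(v in pi) w v.
    by move=> ? ? ?; apply/satisfies_PathGe; apply: sol.
  have wout v : v \notin pi -> 0 <= w v.
    by move=> vpi; apply: (sol (CoordGe0 v)); left.
  have w0 v : 0 <= w v.
    have [vpi|/wout//] := boolP (v \in pi).
    have [[_ [rho [rho_path neq sub vrho]]]|nc] := pselect (corner pi v); last first.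
      by apply: (sol (CoordGe0 v)); right.
    (* Cancelling [pi :\ v] leaves [w v] at least the weight of [rho :\: pi]. *)
    have := wpath _ rho_path neq (corner_star pi_path rho_path vpi vrho sub).
    rewrite (big_setID (A := rho) (pi :\ v)) /= (setIidPr sub).
    rewrite [leRHS](big_setD1 v) //= [leRHS]addrC lerD2l; apply: le_trans.
    apply: sumr_ge0 => x; rewrite !inE => /andP[xpi xrho]; apply: wout.
    by apply: contra xpi => ->; rewrite andbT; apply: contraNneq vrho => <-.
  split=> // rho rho_path; rewrite !dot_indicator.
  exact: path_sum_le.
split=> // c Fc; split; first by rewrite coneE => w sol b [Fb _]; apply: sol.
suff [w [sol nsat]] : exists w : {ffun P -> R},
    solutions R pi (facet_inequalities pi `\ c) w /\ ~ satisfies pi w c.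
  by rewrite coneE => /(_ w sol) /(_ c Fc).
case: c Fc => [v|rho].
  case=> [vpi|[vpi nc]].
    exists [ffun x => - (x == v)%:R]; split; last first.
      by rewrite /= ffunE eqxx oppr_ge0 ler10.
    move=> [x|sigma] [_ neq].
      by rewrite /= ffunE; case: eqP => [xv|_]; [case: neq; rewrite xv | rewrite oppr0].
    have sumE (A : {set P}) :
        \sum_(x in A) [ffun x => - (x == v)%:R : R] x = - (v \in A)%:R.
      by rewrite -(sum_delta R) -sumrN; apply: eq_bigr => x _; rewrite ffunE.
    apply/satisfies_PathGe; rewrite !sumE (negbTE vpi) oppr0 oppr_le0.
    exact: ler0n.
  exists [ffun x => (x \in pi :\ v)%:R - (x == v)%:R]; split; last first.
    by rewrite /= ffunE !inE eqxx sub0r oppr_ge0 ler10.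
  have sumE (A : {set P}) :
        \sum_(x in A) [ffun x => (x \in pi :\ v)%:R - (x == v)%:R : R] x =
      #|A :&: (pi :\ v)|%:R - (v \in A)%:R.
    rewrite -(sum_delta R) -sumr_const big_mkcond [X in _ = X - _]big_mkcond.
    rewrite [X in _ = _ - X]big_mkcond -sumrB; apply: eq_bigr => x _ /=.
    rewrite ffunE [x \in A :&: _]inE; case: (x \in A); rewrite ?subr0 //.
    by case: (_ \in _).
  move=> [x|sigma] [Fx neq].
    rewrite /= ffunE; case: eqP => [xv|_]; first by case: neq; rewrite xv.
    by rewrite subr0 ler0n.
  case: Fx => sigma_path sneq _.
  apply/satisfies_PathGe; rewrite !sumE vpi.
  have -> : pi :&: (pi :\ v) = pi :\ v by apply/setIidPr; apply: subsetDl.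
  have [vs|vs] := boolP (v \in sigma).
    by rewrite lerD2r ler_nat subset_leq_card ?subsetIr.
  rewrite subr0 lerBrDr -natrD ler_nat addn1.
  apply: proper_card; rewrite properE subsetIr /=.
  apply/negP; rewrite subsetI => /andP[sub _].
  by apply: nc; split=> //; exists sigma.
case=> rho_path neq conn.
have [y yY] : exists y, y \in rho :\: pi.
  apply/set0Pn; rewrite setD_eq0; apply: contra neq => sub.
  by apply/eqP/esym; apply: path_sub_eq.
exists [ffun v => (peak_weight pi rho y v)%:R].
have sumE (A : {set P}) :
        \sum_(v in A) [ffun v => (peak_weight pi rho y v)%:R : R] v =
    (\sum_(v in A) peak_weight pi rho y v)%:R.
  by rewrite natr_sum; apply: eq_bigr => v _; rewrite ffunE.
split; last first.
  move/satisfies_PathGe; rewrite !sumE ler_nat leqNgt.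
  by rewrite peak_weight_lt.
move=> [v|sigma] [Fc sneq]; first by rewrite /= ffunE ler0n.
case: Fc => sigma_path _ _.
apply/satisfies_PathGe; rewrite !sumE ler_nat; apply: peak_weight_le => //.
by apply/eqP => sr; apply: sneq; rewrite sr.
Qed.
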